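(* Let $l\ge1$ be an integer, let $\{m_k\}_{k\ge1}$ be an enumeration (in any order) of the integers in $\mathcal D(l)$, let $T=\{t_{n,m}\}$ be a summation matrix satisfying conditions 1)–3) of the context, and let $a_k$, $k\ge1$, be real numbers. If the sums $$\sum_{k}t_{n,k}a_kw_{m_k}(x)$$ converge to zero as $n\to\infty$ for every $x$ in a measurable set $E\subset(0,1)$ of Lebesgue measure $|E|>1-2^{-l}$, then $a_k=0$ for all $k=1,2,\ldots$.
   Context: For an integer $l\ge1$, $\mathcal D(l)$ is the set of integers of the form $m=2^{k_1}+2^{k_2}+\dots+2^{k_l}$ with integers $k_1>k_2>\dots>k_l\ge1$. The Rademacher functions are $r_n(x)=\operatorname{sign}(\sin 2^n\pi x)$, $x\in(0,1)$, $n\ge1$, and the Walsh function for such $m$ is $w_m(x)=r_{k_1}(x)r_{k_2}(x)\cdots r_{k_l}(x)$. Conditions on a matrix $T=\{t_{n,m}:\ m\in\mathbb Z,\ n=1,2,\ldots\}$ of numbers: 1) for each $n$ only finitely many of the $t_{n,m}$, $m\in\mathbb Z$, are nonzero; 2) there is a constant $M$ with $|t_{n,m}|\le M$ for all $n,m$; 3) $\lim_{n\to\infty}t_{n,m}=1$ for every $m=1,2,\ldots$. *)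

(* Defs.v *)
From mathcomp Require Import all_boot all_order all_algebra.
From mathcomp Require Import all_classical all_reals all_analysis.
From mathcomp Require Import complex.

Set Implicit Arguments.
Unset Strict Implicit.
Unset Printing Implicit Defensive.

Import Order.TTheory GRing.Theory Num.Theory.
Import numFieldNormedType.Exports.

Local Open Scope classical_set_scope.
Local Open Scope ring_scope.

(* [:: k_1; ...; k_l] with k_1 > ... > k_l >= 1 and m = \sum_i 2 ^ k_i *)
Definition dyadic_exponents (m : nat) (s : seq nat) : Prop :=
  [/\ sorted gtn s, all (leq 1) s & m = (\sum_(k <- s) 2 ^ k)%N].

Definition dyadic_set (l : nat) : set nat :=
  [set m | exists2 s : seq nat, size s = l & dyadic_exponents m s].

Definition rademacher (R : realType) (n : nat) (x : R) : R :=
  Num.sg (sin (2 ^+ n * pi * x)).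

(* The exponents are unique by [dyadic_exponents_inj], so the choice made by
   [xget] is immaterial, cf. [walshE]. *)
Definition walsh (R : realType) (m : nat) (x : R) : R :=
  \prod_(k <- xget [::] [set s | dyadic_exponents m s]) rademacher k x.

Lemma sum_exp2_lt (s : seq nat) (k : nat) :
  path gtn k s -> (\sum_(i <- s) 2 ^ i < 2 ^ k)%N.
Proof.
elim: s k => [|j s IHs] k /=; first by rewrite big_nil expn_gt0.
move=> /andP[jk /IHs sj]; rewrite big_cons.
apply: (@leq_trans (2 ^ j.+1)%N); last by rewrite leq_exp2l.
by rewrite expnS mul2n -addnn ltn_add2l.
Qed.

Lemma dyadic_exponents_inj (m : nat) (s t : seq nat) :
  dyadic_exponents m s -> dyadic_exponents m t -> s = t.
Proof.
move=> [ss _ ->] [st _]; elim: s t ss st => [|j s IHs] [|k t] //=.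
- by move=> _ _ /eqP; rewrite big_nil big_cons eq_sym addn_eq0 expn_eq0.
- by move=> _ _ /eqP; rewrite big_nil big_cons addn_eq0 expn_eq0.
move=> js kt; rewrite !big_cons => E.
have top (i : nat) (u : seq nat) : path gtn i u ->
    (2 ^ i <= 2 ^ i + \sum_(n <- u) 2 ^ n < 2 ^ i.+1)%N.
  move=> iu; rewrite leq_addr /= expnS mul2n -addnn ltn_add2l.
  exact: sum_exp2_lt.
have /andP[j1 j2] := top _ _ js; have /andP[k1 k2] := top _ _ kt.
have jk : j = k.
  apply/eqP; rewrite eqn_leq; apply/andP; split; rewrite -ltnS.
    by rewrite -(@ltn_exp2l 2)//; apply: leq_ltn_trans j1 _; rewrite E.
  by rewrite -(@ltn_exp2l 2)//; apply: leq_ltn_trans k1 _; rewrite -E.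
move: js E; rewrite jk => js /addnI E.
by congr cons; apply: IHs => //; [exact: path_sorted js|exact: path_sorted kt].
Qed.

Lemma walshE (R : realType) (m : nat) (s : seq nat) (x : R) :
  dyadic_exponents m s -> walsh m x = \prod_(k <- s) rademacher k x.
Proof.
move=> ms; rewrite /walsh; congr bigop.body.
apply: (@dyadic_exponents_inj m) => //.
exact: (@xgetPex _ [::] [set s | dyadic_exponents m s] (ex_intro _ s ms)).
Qed.

(* Complex entries are allowed; R[i]^o carries the topology of the modulus.
   The rows are indexed by n >= 1; the values at n = 0 are irrelevant. *)
Definition summation_matrix (R : realType) (t : nat -> int -> R[i]) : Prop :=
  [/\ forall n : nat, (1 <= n)%N -> finite_set [set m : int | t n m != 0],
      exists M : R, forall (n : nat) (m : int), (1 <= n)%N ->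
        (`|t n m| <= M%:C)%C
    & forall m : int, 1 <= m -> t n m @[n --> \oo] --> (1 : R[i]^o)].

(* Lebesgue (not only Borel) measurability: this sigma-algebra is the Lebesgue
   completion of the Borel sets, by [completed_caratheodory_measurable]. *)
Definition lebesgue_measurable (R : realType) (E : set R) : Prop :=
  ((@wlength R idfun)^*)%mu.-cara.-measurable E.

(* Main.v *)
(* Let [flip k] change the k-th binary digit of [x]: it preserves Lebesgue
   measure and (0, 1), negates r_k and fixes the other r_j. If k_1, ..., k_l are
   the exponents of m, then applying E |-> E `&` flip k_i @^-1` E for each i at
   most doubles the measure of the complement every time, so |E| > 1 - 2^-l
   leaves a set of positive measure. On it the alternating sum of the means
   over all 2^l combinations of flips still tends to 0; but this sum kills
   every Walsh function of order l except w_m, which it multiplies by 2^l. *)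
Require Import Defs.
From mathcomp Require Import all_boot all_order all_algebra finmap.
From mathcomp Require Import all_classical all_reals all_analysis.
From mathcomp Require Import complex.
From mathcomp Require Import measurable_realfun.
From mathcomp Require Import ring lra zify.

Import Order.TTheory GRing.Theory Num.Theory.
Import numFieldNormedType.Exports.

Local Open Scope classical_set_scope.
Local Open Scope ring_scope.

Set Implicit Arguments.
Unset Strict Implicit.
Unset Printing Implicit Defensive.

(** * Flipping one binary digit, and its effect on the Rademacher functions *)

Section Flip.
Variable R : realType.
Implicit Types (x y : R) (j k : nat).

Lemma sinD_intpi (i : int) x : sin (x + pi * i%:~R) = (-1) ^ i * sin x.
Proof.
have sinDn n y : sin (y + pi * n%:R) = (-1) ^+ n * sin y.
  by rewrite mulr_natr; apply: (alternatingn (@sinDpi R)).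
case: i => n; first exact: sinDn.
have := sinDn n.+1 (x + pi * (Negz n)%:~R).
rewrite NegzE mulrNz mulrN -addrA addNr addr0 => ->.
by rewrite -exprnN mulrA mulVf ?mul1r// expf_neq0// oppr_eq0 oner_eq0.
Qed.

Lemma sinD_int2pi (i : int) x : sin (x + pi * (2 * i)%:~R) = sin x.
Proof. by rewrite sinD_intpi -exprz_exp -exprnP sqrrN expr1n exp1rz mul1r. Qed.

(** Removing [pi * q] from the argument costs the sign (-1)^q and leaves a point of (0, pi), where
    the sine is positive. *)
Lemma rademacher_bin k (q : int) x : q%:~R < 2 ^+ k * x < q%:~R + 1 ->
  rademacher k x = Num.sg ((-1) ^ q).
Proof.
move=> /andP[qx xq]; rewrite /rademacher.
rewrite (_ : _ * x = pi * (2 ^+ k * x - q%:~R) + pi * q%:~R); last by ring.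
rewrite sinD_intpi sgrM [X in _ * X]gtr0_sg ?mulr1//.
have pi0 := pi_gt0 R.
apply: sin_gt0_pi; apply/andP; split.
  by rewrite mulr_gt0// subr_gt0.
by rewrite -ltr_pdivlMl// mulVf ?gt_eqF// ltrBlDl.
Qed.

Lemma rademacher_neq0 k x : 2 ^+ k * x != (Num.floor (2 ^+ k * x))%:~R ->
  rademacher k x != 0.
Proof.
move=> xq; rewrite (@rademacher_bin k (Num.floor (2 ^+ k * x))).
  by rewrite sgr_eq0 expfz_neq0// oppr_eq0 oner_eq0.
have /andP[qx xq'] := floor_itv (2 ^+ k * x).
by rewrite intrD in xq'; rewrite xq' andbT lt_neqAle eq_sym xq.
Qed.

(* At dyadic points with r_k x = 0, [flip k] is the identity. *)
Definition flip k x : R := x + rademacher k x / 2 ^+ k.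

(** The flip moves the argument of the sine by pi or -pi; where the sine vanishes nothing moves, and
    both sides are 0. *)
Lemma rademacher_flip k x : rademacher k (flip k x) = - rademacher k x.
Proof.
rewrite /flip {1}/rademacher.
rewrite (_ : _ * (x + _) = 2 ^+ k * pi * x + rademacher k x * pi); last first.
  by field; rewrite expf_neq0.
rewrite /rademacher; case: (sgrP (sin (2 ^+ k * pi * x))) => s.
- by rewrite mul0r addr0 s sgr0 oppr0.
- by rewrite mul1r sinDpi sgrN gtr0_sg.
- rewrite mulN1r opprK -[sin (_ - pi)]opprK -sinDpi subrK.
  by rewrite gtr0_sg// oppr_gt0.
Qed.

Lemma flipK k : involutive (flip k).
Proof.
by move=> x; rewrite {1}/flip rademacher_flip /flip mulNr addrK.
Qed.

(** Dyadic intervals are nested: halving the index [d] times leads from level j + d up to level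
    j. *)
Lemma same_dyadic_bin j d x y (i : int) :
    i%:~R < 2 ^+ (j + d) * x < i%:~R + 1 ->
    i%:~R < 2 ^+ (j + d) * y < i%:~R + 1 ->
  exists q : int,
    q%:~R < 2 ^+ j * x < q%:~R + 1 /\ q%:~R < 2 ^+ j * y < q%:~R + 1.
Proof.
elim: d i => [|d IHd] i; first by rewrite addn0; exists i.
move=> ix iy; apply: (IHd (i %/ 2)%Z); move: ix iy;
  rewrite addnS exprS -!mulrA; set z := _ ^+ _ * _;
  have : (i <= (i %/ 2)%Z * 2 + 1) by lia.
all: have : ((i %/ 2)%Z * 2 <= i) by lia.
all: rewrite -!(ler_int R) !intrD !intrM; lra.
Qed.

(** In a dyadic interval of level k - 1, r_k is 1 on the left half and -1 on the right half, so the
    flip moves x by half the length into the other half. Thus x stays in its interval at level k -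
    1, hence at every coarser level. *)
Lemma flip_bin j k x : (j < k)%N -> rademacher k x != 0 -> exists q : int,
  q%:~R < 2 ^+ j * x < q%:~R + 1 /\ q%:~R < 2 ^+ j * flip k x < q%:~R + 1.
Proof.
case: k => // k; rewrite ltnS => jk rx.
(* The flipped digit is now [k.+1], and [th] is the relative position of x in its interval of level
   [k]. A nonzero r_(k+1) excludes the left endpoint and the midpoint. *)
pose i := Num.floor (2 ^+ k * x); pose th : R := 2 ^+ k * x - i%:~R.
have rE : rademacher k.+1 x = Num.sg (sin (2 * pi * th)).
  rewrite /rademacher; congr Num.sg.
  rewrite (_ : _ * x = 2 * pi * th + pi * (2 * i)%:~R); last first.
    by rewrite intrM /th exprS; ring.
  by rewrite sinD_int2pi.
have flipE : 2 ^+ k * flip k.+1 x = i%:~R + th + rademacher k.+1 x / 2.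
  by rewrite /flip /th exprS; field; rewrite expf_neq0.
have th01 : 0 <= th < 1.
  by have := floor_itv (2 ^+ k * x); rewrite intrD -/i /th; lra.
have thn0 : th != 0.
  by apply: contra_neq rx => th0; rewrite rE th0 mulr0 sin0 sgr0.
have thn12 : th != 2^-1.
  by apply: contra_neq rx => th12;
    rewrite rE th12 mulrAC divff// mul1r sinpi sgr0.
have pi0 := pi_gt0 R.
have flip01 : 0 < th + rademacher k.+1 x / 2 < 1.
  have [th12|th12|/eqP] := ltgtP th 2^-1; last by rewrite (negbTE thn12).
    rewrite rE gtr0_sg; first by lra.
    by apply: sin_gt0_pi; nra.
  rewrite rE (_ : 2 * pi * th = 2 * pi * (th - 2^-1) + pi); last by field.
  rewrite sinDpi sgrN gtr0_sg; first by lra.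
  by apply: sin_gt0_pi; nra.
apply: (@same_dyadic_bin j (k - j) _ _ i);
  by rewrite subnKC// ?flipE /th in th01 thn0 flip01 *; lra.
Qed.

(** For j < k both points share an interval of level j. For j > k the shift by 2^-k is an integer
    multiple of the period 2^(1-j) of r_j. *)
Lemma rademacher_flip_neq j k x : (0 < j)%N -> j != k ->
  rademacher j (flip k x) = rademacher j x.
Proof.
move=> j0; rewrite neq_ltn => /orP[jk|kj].
  have [r0|/(flip_bin jk)[q [xq yq]]] := eqVneq (rademacher k x) 0.
    by rewrite /flip r0 mul0r addr0.
  by rewrite (rademacher_bin xq) (rademacher_bin yq).
rewrite /rademacher; congr Num.sg; rewrite /flip.
have [i ->] : exists i : int, rademacher k x = i%:~R.
  rewrite /rademacher; case: sgrP => _;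
    [by exists 0|by exists 1|by exists (-1)].
rewrite -[j](subnKC kj) (_ : _ * (x + _) = 2 ^+ (k.+1 + (j - k.+1)) * pi * x +
   pi * (2 * (2 ^+ (j - k.+1) * i))%:~R); last first.
  by rewrite !intrM rmorphXn /= exprD exprS; field; rewrite expf_neq0.
by rewrite sinD_int2pi.
Qed.

(** This is [flip_bin] at level 0, whose intervals are the unit intervals between consecutive
    integers. *)
Lemma flip_itv01 k x : (0 < k)%N -> (0 < flip k x < 1) = (0 < x < 1).
Proof.
move=> k0; have [r0|/(flip_bin k0)[q]] := eqVneq (rademacher k x) 0.
  by rewrite /flip r0 mul0r addr0.
rewrite expr0 !mul1r => -[/andP[qx xq] /andP[qy yq]].
have e (z : R) : q%:~R < z -> z < q%:~R + 1 -> (0 < z < 1) = (q == 0).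
  move=> qz zq; apply/idP/eqP => [/andP[z0 z1]|q0];
    last by rewrite q0 in qz zq; lra.
  have : (q < 1) by rewrite -(ltr_int R); lra.
  have : (-1 < q) by rewrite -(ltr_int R) mulrN1z; lra.
  by lia.
by rewrite !e.
Qed.

End Flip.

(** * Measure invariance of the flip, and reduction to Borel sets *)

Section FlipMeasure.
Variable R : realType.
Implicit Types (k : nat) (A B : set R).
Local Notation mu := (@lebesgue_measure R).

Lemma measurable_rademacher k : measurable_fun setT (@rademacher R k).
Proof.
have sgm : measurable_fun setT (@Num.sg R).
  apply: nondecreasing_measurable => // x y xy.
  by case: (sgrP x); case: (sgrP y); lra.
have -> : @rademacher R k = Num.sg \o (sin \o (fun x => (2 ^+ k * pi) * x)).
  by apply/funext.
apply: measurableT_comp => //; apply: measurableT_comp.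
  by apply: continuous_measurable_fun; exact: continuous_sin.
exact: measurable_funM.
Qed.

Lemma measurable_flip k : measurable_fun setT (@flip R k).
Proof.
apply: measurable_funD => //; apply: measurable_funM => //.
exact: measurable_rademacher.
Qed.

Lemma lebesgue_measure_shift (h : R) B : measurable B ->
  mu ((fun x => x + h) @^-1` B) = mu B.
Proof.
move=> mB.
rewrite -[LHS]/(pushforward mu ((fun x => x + h) : _ -> measurableTypeR R) B).
apply/esym/lebesgue_measure_unique => //=; first exact: measurable_funD.
move=> mf _ [[a b]] _ <-; rewrite /pushforward/=.
have -> : (fun x => x + h) @^-1` `]a, b] = `]a - h, b - h]%classic.
  by apply/seteqP; split=> x; rewrite /= !in_itv/= ltrBlDr lerBrDr.
rewrite !lebesgue_measure_itv/= !lte_fin ltrD2r.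
by case: ifP => // _; rewrite -!EFinB; congr (_%:E); lra.
Qed.


(** The flip is a piecewise translation: it shifts {r_k = 1} onto {r_k = -1} by 2^-k, shifts back
    the other way, and fixes {r_k = 0}. *)
Lemma lebesgue_measure_flip k B : measurable B -> mu (flip k @^-1` B) = mu B.
Proof.
move=> mB.
have mr (c : R) : measurable [set x | rademacher k x = c].
  by rewrite -[X in measurable X]setTI;
    exact: (@measurable_rademacher k measurableT [set c]).
pose P := [set x : R | rademacher k x = 1].
pose N := [set x : R | rademacher k x = -1].
have mP : measurable P by exact: mr.
have mN : measurable N by exact: mr.
have split3 A : measurable A ->
    mu A = (mu (A `\` P `\` N) + mu (A `&` N) + mu (A `&` P))%E.
  move=> mA; rewrite (measureDI mu mA mP) (measureDI mu (measurableD mA mP) mN).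
  congr (_ + mu _ + _)%E; apply/seteqP.
  split => [x [[]]//|x [Ax Nx]]; split=> //; split=> //.
  by rewrite /P /N /= in Nx *; rewrite Nx; lra.
have mfB : measurable (flip k @^-1` B).
  by rewrite -[X in measurable X]setTI; apply: measurable_flip.
rewrite (split3 _ mfB) (split3 _ mB).
rewrite -(lebesgue_measure_shift (- (2 ^- k)) (measurableI _ _ mB mP)).
rewrite -(lebesgue_measure_shift (2 ^- k) (measurableI _ _ mB mN)).
(* The flip exchanges [P] and [N], so these two summands are matched crosswise. *)
rewrite -addeA [X in (_ + X)%E]addeC addeA.
congr (mu _ + mu _ + mu _)%E.
- apply/seteqP; split=> x [[/= Bx Px] Nx]; split=> //; split=> //; move: Bx;
  by rewrite /flip; move: Px Nx; rewrite /P /N /= /rademacher;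
     case: sgrP => //; rewrite mul0r addr0.
- apply/seteqP; split=> x /=.
    by move=> [Bx Px]; rewrite -[N _]/(_ = _);
     move: (rademacher_flip k x) Bx; rewrite /flip Px mul1r.
  move=> [Bx Nx].
  have E : x = flip k (x + 2 ^- k) by rewrite /flip Nx mulN1r addrK.
  have Px : rademacher k x = 1 by rewrite E rademacher_flip Nx opprK.
  by split => //; rewrite /flip Px mul1r.
- apply/seteqP; split=> x /=.
    by move=> [Bx Px]; rewrite -[P _]/(_ = _);
     move: (rademacher_flip k x) Bx; rewrite /flip Px mulN1r opprK.
  move=> [Bx Nx].
  have E : x = flip k (x - 2 ^- k) by rewrite /flip Nx mul1r subrK.
  have Px : rademacher k x = -1 by rewrite E rademacher_flip Nx.
  by split => //; rewrite /flip Px mulN1r.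
Qed.

(** Both sets lie in (0, 1) and have the same measure, so by inclusion-exclusion their intersection
    has measure at least 2 |A| - 1. *)
Lemma lebesgue_measure_flipI k A (c : R) : (0 < k)%N -> measurable A ->
    A `<=` `]0, 1[ -> ((1 - c / 2)%:E < mu A)%E ->
  ((1 - c)%:E < mu (A `&` flip k @^-1` A))%E.
Proof.
move=> k0 mA A01 cA.
have mfA : measurable (flip k @^-1` A).
  by rewrite -[X in measurable X]setTI; apply: measurable_flip.
have mu01 : mu `]0, 1[ = 1%E.
  by rewrite lebesgue_measure_itv/= lte01 oppr0 adde0.
have U1 : (mu (A `|` flip k @^-1` A) <= 1)%E.
  rewrite -mu01 le_measure ?inE//; first exact: measurableU.
  move=> x [/A01//|/A01/=]; rewrite !in_itv/= flip_itv01//.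
have A1 : (mu A <= 1)%E by rewrite -mu01 le_measure ?inE.
have Aoo : (mu A < +oo)%E by exact: le_lt_trans A1 (ltry _).
move: U1; rewrite measureUfinl//= lebesgue_measure_flip//.
have : (mu (A `&` flip k @^-1` A) <= mu A)%E by exact: measureIl.
have : (0 <= mu (A `&` flip k @^-1` A))%E by exact: measure_ge0.
case: (mu (A `&` _)) => [i| |]//; last first.
  by move=> _; rewrite leye_eq => /eqP AE; rewrite AE in Aoo.
case: (mu A) cA => [r| |]//; rewrite -!EFinD !lee_fin !lte_fin; lra.
Qed.

(** A zero of r_k is an integer divided by 2^k. Hence a set of positive measure has a point where no
    r_k vanishes. *)
Lemma countable_rademacher_eq0 :
  countable [set x : R | exists k, rademacher k x = 0].
Proof.
apply: (@sub_countable _ _ _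
  (range (fun p : nat * int => p.2%:~R / 2 ^+ p.1 : R))).
  apply: subset_card_le => x [k rx] /=.
  exists (k, Num.floor (2 ^+ k * x)) => //=.
  have [<-|/rademacher_neq0] :=
    eqVneq (2 ^+ k * x) (Num.floor (2 ^+ k * x))%:~R.
    by rewrite mulrAC divff ?mul1r// expf_neq0.
  by rewrite rx eqxx.
exact: card_le_trans (card_image_le _ _) (countableP _).
Qed.

(** A set of the completion is a Borel set joined with part of a null set. The Borel part carries
    the whole measure, and its preimages under flips are again Borel. *)
Lemma lebesgue_measurable_inner (E : set R) : lebesgue_measurable E ->
  exists A, [/\ measurable A, A `<=` E & completed_lebesgue_measure E = mu A].
Proof.
rewrite /lebesgue_measurable -completed_caratheodory_measurable.
rewrite g_sigma_completed_algebra_genE => -[A mA [N [F [mF F0 NF]]] <-].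
exists A; split=> //.
apply/eqP; rewrite eq_le; apply/andP; split; last first.
  by apply: le_outer_measure; exact: subsetUl.
apply: (@le_trans _ _ (mu (A `|` F))).
  by apply: le_outer_measure; exact: setUS.
by rewrite measureU0.
Qed.

End FlipMeasure.

(** * Isolating one Walsh function by differences of flipped means *)

Lemma rademacher_prod_flip (R : realType) (s : seq nat) (j : nat) (x : R) :
  uniq s -> all (leq 1) s ->
  \prod_(i <- s) rademacher i (flip j x) =
  (if j \in s then -1 else 1) * \prod_(i <- s) rademacher i x.
Proof.
elim: s => [|i s IHs] /=; first by rewrite !big_nil mulr1.
move=> /andP[nis us] /andP[i1 s1]; rewrite !big_cons IHs// inE.
have [->|ji] := eqVneq j i.
  by rewrite rademacher_flip (negbTE nis) mul1r mulN1r mulNr.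
by rewrite rademacher_flip_neq 1?eq_sym//= mulrCA.
Qed.

Section Isolation.
Variables (R : realType) (t : nat -> int -> R[i]) (e : nat -> seq nat).
Local Notation K := [set k : nat | (1 <= k)%N].
Local Notation mu := (@lebesgue_measure R).
Hypothesis tfin : forall n, (1 <= n)%N -> finite_set [set m : int | t n m != 0].
Hypothesis e_uniq : forall k, (1 <= k)%N -> uniq (e k).
Hypothesis e_gt0 : forall k, (1 <= k)%N -> all (leq 1) (e k).

(** The coefficients [b] are a parameter because the difference of a mean and its flip is again a
    mean, with new coefficients. *)
Definition rademacher_mean (b : nat -> R) (n : nat) (x : R) : R[i]^o :=
  \sum_(k \in K) t n k%:Z * (b k * \prod_(i <- e k) rademacher i x)%:C%C.

(** A sum [\sum_(k \in K)] with infinite support is 0 by convention, so additivity is not automatic;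
    the finite support of row [n] serves as a common index set. *)
Lemma fsum_row n (f g : nat -> R[i]) : (1 <= n)%N ->
  \sum_(k \in K) t n k%:Z * (f k - g k) =
  \sum_(k \in K) t n k%:Z * f k - \sum_(k \in K) t n k%:Z * g k.
Proof.
move=> n1; pose D := [set k : nat | t n k%:Z != 0].
have KDfin : finite_set (K `&` D).
  apply: sub_finite_set (finite_preimage (f := Posz) _ (tfin n1)).
    by move=> k [].
  by move=> x y _ _ [].
have KDE (h : nat -> R[i]) : \sum_(k \in K) t n k%:Z * h k =
    \sum_(k <- fset_set (K `&` D)) t n k%:Z * h k.
  rewrite -fsbig_finite//; apply/esym/fsbig_widen; first by move=> k [].
  by move=> k [Kk /not_andP[//|/negP]] /=;
    rewrite negbK => /eqP ->; rewrite mul0r.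
by rewrite !KDE -sumrB; apply: eq_bigr => k _; rewrite mulrBr.
Qed.

(** A term containing r_j changes sign under the flip and is doubled by the difference; any other
    term cancels. *)
Lemma rademacher_mean_flip b n j x : (1 <= n)%N ->
  rademacher_mean b n x - rademacher_mean b n (flip j x) =
  rademacher_mean (fun k => b k * (if j \in e k then 2 else 0)) n x.
Proof.
move=> n1; rewrite /rademacher_mean -fsum_row//.
apply: eq_fsbigr => k /set_mem/= k1.
rewrite -rmorphB/= rademacher_prod_flip ?e_uniq ?e_gt0//.
by congr (_ * _%:C%C); case: ifP => _; ring.
Qed.

(** Induction on [s] with [A] and [b] general: the head [j] shrinks [A] to the points whose flip is
    also in [A], and its factor 2 or 0 is absorbed into [b]. *)
Lemma rademacher_mean_isolate (s : seq nat) (A : set R) (b : nat -> R) :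
  all (leq 1) s -> measurable A -> A `<=` `]0, 1[ ->
  ((1 - 2 ^- size s)%:E < mu A)%E ->
  (forall x, A x -> rademacher_mean b n x @[n --> \oo] --> (0 : R[i]^o)) ->
  exists A' : set R, (0 < mu A')%E /\ forall x, A' x ->
    rademacher_mean
      (fun k => b k * \prod_(j <- s) (if j \in e k then 2 else 0)) n x
        @[n --> \oo] --> (0 : R[i]^o).
Proof.
elim: s A b => [|j s IHs] A b /=.
  rewrite expr0 invr1 subrr => _ _ _ A0 cvgA; exists A; split=> // x /cvgA.
  rewrite (_ : (fun k => _) = b)//; apply/funext => k.
  by rewrite big_nil mulr1.
move=> /andP[j1 s1] mA A01 muA cvgA.
have mfA : measurable (A `&` flip j @^-1` A).
  by apply: measurableI => //;
    rewrite -[X in measurable X]setTI; apply: measurable_flip.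
have [||x [Ax Afx]|A' [A'0 cvgA']] :=
  IHs _ (fun k => b k * (if j \in e k then 2 else 0)) s1 mfA.
- by move=> x [/A01].
(* Here c = 2^-|s| for the tail [s], so that c / 2 is the bound assumed on [A]. *)
- by apply: lebesgue_measure_flipI => //; rewrite -invfM -exprSr.
- apply: (@cvg_trans _
    ((rademacher_mean b n x - rademacher_mean b n (flip j x)) @[n --> \oo])).
    apply: near_eq_cvg; near=> n; rewrite rademacher_mean_flip//.
    by near: n; exact: nbhs_infty_ge.
  have /(_ _) := cvgB (cvgA _ Ax) (cvgA _ Afx); rewrite subr0; exact.
- exists A'; split=> // x /cvgA'.
  rewrite (_ : (fun k => _) =
    (fun k => b k * \prod_(i <- j :: s) (if i \in e k then 2 else 0)))//.
  by apply/funext => k; rewrite big_cons mulrA.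
Unshelve. all: by end_near. Qed.

End Isolation.

(** * Choice of the exponents and passage to the limit *)

Theorem theorem1p7 (R : realType) (l : nat) (m : nat -> nat)
    (t : nat -> int -> R[i]) (a : nat -> R) (E : set R)
    (hl : (1 <= l)%N)
    (hm : set_bij [set k : nat | (1 <= k)%N] (dyadic_set l) m)
    (ht : summation_matrix t)
    (hE : lebesgue_measurable E)
    (hE01 : E `<=` `]0, 1[)
    (hEmu : ((1 - 2 ^- l)%:E < completed_lebesgue_measure E)%E)
    (hcvg : forall x : R, E x ->
      (\sum_(k \in [set k : nat | (1 <= k)%N])
         t n k%:Z * (a k * walsh (m k) x)%:C%C) @[n --> \oo] --> (0 : R[i]^o)) :
  forall k : nat, (1 <= k)%N -> a k = 0.
Proof.
have [tfin _ t1] := ht; have [mD minj _] := hm.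
have /choice[e eP] : forall k, exists s,
    (1 <= k)%N -> size s = l /\ dyadic_exponents (m k) s.
  move=> k; have [/mD[s sl ms]|_] := boolP (1 <= k)%N; last by exists [::].
  by exists s.
have e_size k : (1 <= k)%N -> size (e k) = l by move=> /eP[].
have e_sorted k : (1 <= k)%N -> sorted gtn (e k) by move=> /eP[_ []].
have e_gt0 k : (1 <= k)%N -> all (leq 1) (e k) by move=> /eP[_ []].
have gtn_trans : transitive gtn.
  by move=> y x z /= yx zy; exact: ltn_trans zy yx.
have e_uniq k : (1 <= k)%N -> uniq (e k).
  by move=> /e_sorted; apply: sorted_uniq => // x; exact: ltnn.
move=> k0 k01.
(* Lists of equal size without repetition, one included in the other, have the same entries; being
   sorted they coincide, and injectivity of [m] gives k = k0. *)
have e_neq k : (1 <= k)%N -> k != k0 -> exists2 j, j \in e k0 & j \notin e k.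
  move=> k1 /eqP kk0; apply/allPn; apply: contra_notN kk0 => /allP sub.
  have eqe : e k0 =i e k.
    apply: (uniq_min_size (e_uniq _ k01) sub _).2; by rewrite !e_size.
  have ee : e k0 = e k.
    apply: (irr_sorted_eq gtn_trans _ (e_sorted _ k01) (e_sorted _ k1) eqe).
    exact: ltnn.
  apply: minj; [exact: mem_set|exact: mem_set|].
  by have [_ [_ _ ->]] := eP _ k1; have [_ [_ _ ->]] := eP _ k01; rewrite ee.
have [A [mA AE EA]] := lebesgue_measurable_inner hE.
have cvgA x : A x -> rademacher_mean t e a n x @[n --> \oo] --> (0 : R[i]^o).
  move=> /AE/hcvg; rewrite (_ : (fun n => _) = rademacher_mean t e a ^~ x)//.
  apply/funext => n; apply: eq_fsbigr => k /set_mem/= k1.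
  by rewrite (walshE _ (eP _ k1).2).
have [] := rademacher_mean_isolate tfin e_uniq e_gt0 (e_gt0 _ k01) mA _ _ cvgA.
- exact: subset_trans AE hE01.
- by rewrite e_size// -EA.
move=> B [B0 cvgB].
have [x [Bx rx]] : exists x, B x /\ forall j, rademacher j x != 0.
  apply: contrapT => nx; move: B0; rewrite countable_lebesgue_measure0 ?ltxx//.
  apply: sub_countable (@countable_rademacher_eq0 R).
  apply: subset_card_le => x Bx /=.
  apply: contra_notP nx => nr; exists x; split => // j; apply/eqP => rj0.
  by apply: nr; exists j.
have Wx : \prod_(i <- e k0) rademacher i x != 0.
  by rewrite prodf_seq_neq0; apply/allP => i _; exact: rx.
set z : R := a k0 * \prod_(j <- e k0) (if j \in e k0 then 2 else 0) *
   \prod_(i <- e k0) rademacher i x.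
(* For k other than [k0], some exponent in [e k0] is missing from [e k] and contributes a factor 0;
   only the term [k0] survives. *)
have meanE n : rademacher_mean t e
    (fun k => a k * \prod_(j <- e k0) (if j \in e k then 2 else 0)) n x =
    t n k0%:Z * z%:C%C.
  rewrite /rademacher_mean -(fsbig_widen [set k0]) ?fsbig_set1//.
    by move=> _ ->.
  move=> k [/= k1 /eqP kk0]; have [j jk0 jk] := e_neq _ k1 kk0.
  rewrite (_ : \prod_(j <- e k0) _ = 0) ?mulr0 ?mul0r ?mulr0//.
  by apply/eqP; rewrite prodf_seq_eq0; apply/hasP; exists j => //;
    rewrite (negbTE jk) eqxx.
(* The same sequence tends to z, because t_(n,k0) tends to 1, and to 0, because x lies in [B]. *)
have z0 : z%:C%C = 0.
  have tz : t n k0%:Z * z%:C%C @[n --> \oo] --> (1 * z%:C%C : R[i]^o).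
    by apply: cvgM; [exact: t1|exact: cvg_cst].
  have tz0 : t n k0%:Z * z%:C%C @[n --> \oo] --> (0 : R[i]^o).
    by rewrite -(funext meanE); exact: cvgB.
  rewrite -[LHS]mul1r -(cvg_lim (@norm_hausdorff R[i] R[i]^o) tz).
  exact: (cvg_lim (@norm_hausdorff R[i] R[i]^o) tz0).
(* The other factors of z are nonzero: a product of 2s, and a Walsh value at x. *)
have : z == 0 by move: z0 => [->].
rewrite /z !mulf_eq0 (negbTE Wx) orbF => /orP[/eqP//|].
rewrite prodf_seq_eq0 => /hasP[j jk0].
by rewrite jk0 pnatr_eq0.
Qed.
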